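(* Fix $\mathrm{VAR}>0$ and $\psi_1>0$. There exist $N\in\mathbb N$ and sequences $a_n=\Theta(n^{-2/3})$ and $b_n=\Theta(n^{-1/3})$ (of positive numbers, with constants depending only on $\psi_1$ and $\mathrm{VAR}$) such that for every $n\ge N$ the following holds. If the virtual costs of users $1,\dots,n-1$ are all equal to $\psi_1$ and the virtual cost of user $n$ is $$\psi_n\in\left[\psi_1+a_n,\ \psi_1+b_n\right],$$ then the optimal privacy loss level of user $n$ in the local setting is zero, while her optimal privacy loss level in the central setting is non-zero.
   Context: For virtual costs $\psi^{(1)},\dots,\psi^{(n)}>0$ of users $1,\dots,n$ (here $\psi^{(i)}=\psi_1$ for $i\le n-1$ and $\psi^{(n)}=\psi_n$): the optimal privacy loss levels in the central setting are the components of an optimal solution of $$\min_{\mathbf y\in[0,\infty)^n}\ \frac{n+1}{\left(\sum_{j=1}^n y_j\right)^2}\Big(2+\sum_{i=1}^n y_i^2\,\mathrm{VAR}\Big)+\sum_{i=1}^n\psi^{(i)}y_i ;$$ the optimal privacy loss levels in the local setting are the components of an optimal solution of $$\min_{\mathbf y\in[0,\infty)^n}\ \frac{n+1}{\sum_{i=1}^n\frac{1}{\mathrm{VAR}+\frac{2}{y_i^2}}}+\sum_{i=1}^n\psi^{(i)}y_i ,$$ with the convention $\frac{1}{\mathrm{VAR}+2/y^2}=0$ when $y=0$, and division of a positive number by zero equal to $+\infty$. $\mathrm{VAR}$ is the variance of the users' data. $f(n)=\Theta(g(n))$ means there exist $n_0$ and constants $k_1,k_2>0$ such that $k_1g(n)\le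 f(n)\le k_2g(n)$ for all $n\ge n_0$. *)

(* Defs.v *)
From mathcomp Require Import all_boot all_order all_algebra.
From mathcomp Require Import all_classical all_reals all_analysis.

Set Implicit Arguments.
Unset Strict Implicit.
Unset Printing Implicit Defensive.

Import Order.TTheory GRing.Theory Num.Theory.
Import numFieldNormedType.Exports.

Local Open Scope classical_set_scope.
Local Open Scope ring_scope.

(* The objectives are extended-real valued so that the division of the library
   provides the conventions: [0^-1 = +oo] and [+oo^-1 = 0] on [\bar R]. *)

(* [+oo] when all [y_i] vanish, since [2 + \sum_i y_i^2 VAR > 0]. *)
Definition central_objective (R : realType) (n : nat) (VAR : R)
    (psi : 'I_n -> R) (y : 'rV[R]_n) : \bar R :=
  ((n.+1%:R)%:E / ((\sum_(j < n) y ord0 j) ^+ 2)%:E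
     * (2 + \sum_(i < n) y ord0 i ^+ 2 * VAR)%:E
   + (\sum_(i < n) psi i * y ord0 i)%:E)%E.

(* If [y_i = 0] then [2 / y_i^2 = +oo] and the [i]-th term of the sum is [0];
   if all [y_i] vanish the objective is [+oo]. *)
Definition local_objective (R : realType) (n : nat) (VAR : R)
    (psi : 'I_n -> R) (y : 'rV[R]_n) : \bar R :=
  ((n.+1%:R)%:E / (\sum_(i < n) (VAR%:E + 2%:E / (y ord0 i ^+ 2)%:E)^-1)
   + (\sum_(i < n) psi i * y ord0 i)%:E)%E.

Definition optimal_solution (R : realType) (n : nat)
    (objective : 'rV[R]_n -> \bar R) : set 'rV[R]_n :=
  [set y : 'rV[R]_n | (forall i, 0 <= y ord0 i) /\
           forall z : 'rV[R]_n, (forall i, 0 <= z ord0 i) ->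
             (objective y <= objective z)%E].

(* Optimal solutions need not be unique: "the optimal privacy loss level of
   user [u] satisfies [P]" means that an optimal solution exists and that
   every optimal solution satisfies [P] at its [u]-th component. *)
Definition optimal_level (R : realType) (n : nat)
    (objective : 'rV[R]_n -> \bar R) (u : 'I_n) (P : R -> Prop) : Prop :=
  optimal_solution objective !=set0 /\
  forall y, optimal_solution objective y -> P (y ord0 u).

(* Main.v *)
(* Writing [d = psi u - psi1] for the extra cost of the last user, both
   objectives have the form [(n + 1) / gain y + psi1 * \sum_i y_i + d * y_u] and
   are coercive, so optimal solutions exist by compactness of sublevel sets.

   Central setting: giving everybody [n^(-2/3)] costs [O(n^(1/3))], so an optimal
   solution has [\sum_i y_i = O(n^(1/3))]. If [y_u = 0], averaging [y_u] with the
   largest component [y_j] keeps the sum and lowers the variance term by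
   [(n + 1) VAR y_j^2 / (2 (\sum_i y_i)^2)], which exceeds the extra cost
   [d y_j / 2] as soon as [d (\sum_i y_i) <= VAR].

   Local setting: with [k] about [sqrt n], giving level [1] to [k] of the cheap
   users costs [O(k)]. Exchanging two components shows that [y_u] is the smallest
   component of an optimal solution, hence [y_u = O(1 / k)]. The gain being
   quadratic near [0], a positive [y_u] would contribute only [O(y_u^2)] to the
   first term while costing at least [psi1 * y_u], so resetting it to [0] improves
   the objective for large [k]. *)
Require Import Defs.
From mathcomp Require Import all_boot all_order all_algebra.
From mathcomp Require Import all_classical all_reals all_analysis.
From mathcomp Require Import perm ring lra.

Set Implicit Arguments.
Unset Strict Implicit.
Unset Printing Implicit Defensive.

Import Order.TTheory GRing.Theory Num.Theory.
Import numFieldNormedType.Exports.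

Local Open Scope classical_set_scope.
Local Open Scope ring_scope.

(** * Objectives made of a constant over a gain plus a linear cost, and their minimisers *)

Definition gain_objective (R : realType) (n : nat) (c : R)
    (H L : 'rV[R]_n -> R) (y : 'rV[R]_n) : \bar R :=
  (c%:E / (H y)%:E + (L y)%:E)%E.

Definition linear_cost (R : realType) (n : nat) (psi : 'I_n -> R)
    (y : 'rV[R]_n) : R := \sum_(i < n) psi i * y ord0 i.

(** The reciprocal of the factor of [n + 1] in the central objective. It vanishes exactly when the
    total level does, which is where that objective is [+oo]. *)
Definition central_gain (R : realType) (n : nat) (VAR : R) (y : 'rV[R]_n) : R :=
  (\sum_(i < n) y ord0 i) ^+ 2 / (2 + \sum_(i < n) y ord0 i ^+ 2 * VAR).

(** This is [1 / (VAR + 2 / t^2)] with denominators cleared, which removes the singularity at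
    [t = 0] and gives the conventional value [0] there. *)
Definition local_gain1 (R : realType) (VAR t : R) : R :=
  t ^+ 2 / (VAR * t ^+ 2 + 2).

Definition local_gain (R : realType) (n : nat) (VAR : R) (y : 'rV[R]_n) : R :=
  \sum_(i < n) local_gain1 VAR (y ord0 i).

Lemma gain_objective_gt0 (R : realType) (n : nat) (c : R) (H L : 'rV[R]_n -> R)
    (y : 'rV[R]_n) :
  0 < H y -> gain_objective c H L y = (c / H y + L y)%:E.
Proof. by move=> Hy; rewrite /gain_objective inver gt_eqF. Qed.

Lemma gain_objective_eq0 (R : realType) (n : nat) (c : R) (H L : 'rV[R]_n -> R)
    (y : 'rV[R]_n) :
  0 < c -> H y = 0 -> gain_objective c H L y = +oo%E.
Proof.
by move=> c0 Hy; rewrite /gain_objective inver Hy eqxx gt0_muley ?lte_fin.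
Qed.

(** A competitor of positive gain has a finite value, whereas gain [0] costs [+oo]. This moves
    optimality from the extended reals to the reals. *)
Lemma gain_objective_optimal (R : realType) (n : nat) (c : R)
    (H L : 'rV[R]_n -> R) (y z : 'rV[R]_n) :
  0 < c -> (forall x, 0 <= H x) ->
  optimal_solution (gain_objective c H L) y ->
  (forall i, 0 <= z ord0 i) -> 0 < H z ->
  0 < H y /\ c / H y + L y <= c / H z + L z.
Proof.
move=> c0 H0 [_ yopt] z0 Hz; have := yopt z z0.
rewrite (gain_objective_gt0 _ _ Hz).
have := H0 y; rewrite le_eqVlt => /predU1P[Hy0|Hy].
  by rewrite gain_objective_eq0.
by rewrite gain_objective_gt0 // lee_fin.
Qed.

(* The sublevel set of a point of positive gain is closed, and bounded because
   [L] is coercive; the gain is bounded away from [0] on it. *)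
Lemma gain_objective_optimal_exists (R : realType) (n : nat) (c p : R)
    (H L : 'rV[R]_n -> R) (z : 'rV[R]_n) :
  0 < c -> 0 < p -> (forall x, 0 <= H x) -> continuous H -> continuous L ->
  (forall (y : 'rV[R]_n) i, (forall j, 0 <= y ord0 j) -> p * y ord0 i <= L y) ->
  (forall y : 'rV[R]_n, (forall j, 0 <= y ord0 j) -> 0 <= L y) ->
  (forall i, 0 <= z ord0 i) -> 0 < H z ->
  optimal_solution (gain_objective c H L) !=set0.
Proof.
move=> c0 p0 H0 cH cL Lcoer L0 z0 Hz.
set F := fun y : 'rV[R]_n => c / H y + L y.
have FzP : 0 < F z by rewrite ltr_wpDr ?L0 // divr_gt0.
(* Both [p * y_i] and [c / H y] are at most [F y], so the points with [F y <= F z] lie in the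
   compact set [B] intersected with [A]. A minimum there is global, since [z] itself belongs to
   it. *)
pose B := [set y : 'rV[R]_n | forall i, `[0, F z / p]%classic (y ord0 i)].
pose A := H @^-1` [set t | c / F z <= t].
have clA : closed A.
  by apply: (preimage_closed _ (@closed_ge R (c / F z))) => y _; exact: cH.
have cB : compact B.
  apply: (@rV_compact _ _ (fun=> `[0, F z / p]%classic)) => i.
  exact: segment_compact.
have cK : compact (B `&` A) by exact: compact_closedI.
have inK (y : 'rV[R]_n) :
    (forall i, 0 <= y ord0 i) -> 0 < H y -> F y <= F z -> (B `&` A) y.
  move=> y0 Hy Fyz; split.
    move=> i /=; rewrite in_itv /= y0 /= ler_pdivlMr // mulrC.
    rewrite (le_trans (Lcoer _ _ y0)) // (le_trans _ Fyz) // lerDr.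
    by rewrite divr_ge0 // ltW.
  rewrite /A /= ler_pdivrMr // mulrC -ler_pdivrMr // (le_trans _ Fyz) //.
  by rewrite lerDl L0.
have Kpos (y : 'rV[R]_n) : (B `&` A) y -> 0 < H y.
  by move=> [_]; apply: lt_le_trans; rewrite divr_gt0.
have cF : {within B `&` A, continuous F}.
  apply: continuous_in_subspaceT => y /set_mem /Kpos Hy.
  apply: (@continuousD _ _ _ (fun x => c / H x) L); last exact: cL.
  apply: continuousM; first exact: cst_continuous.
  by apply: continuousV; [rewrite gt_eqF|exact: cH].
have K0 : B `&` A !=set0 by exists z; exact: inK.
have [y /set_mem yK ymin] := EVT_min_rV K0 cK cF.
have Hy := Kpos _ yK.
have y0 i : 0 <= y ord0 i by case: yK => /(_ i) /=; rewrite in_itv => /andP[].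
exists y; split=> // x x0.
have := H0 x; rewrite le_eqVlt => /predU1P[Hx0|Hx].
  by rewrite [gain_objective _ _ _ x]gain_objective_eq0 // leey.
rewrite !gain_objective_gt0 // lee_fin -/(F x) -/(F y).
have [Fxz|/ltW Fzx] := leP (F x) (F z).
  by apply: ymin; apply/mem_set/inK.
by apply: le_trans Fzx; apply: ymin; apply/mem_set/inK.
Qed.

(** * Both objectives in gain form *)

Lemma local_den_gt0 (R : realType) (VAR t : R) :
  0 < VAR -> 0 < VAR * t ^+ 2 + 2.
Proof. by move=> V0; rewrite ltr_wpDl // mulr_ge0 ?sqr_ge0 // ltW. Qed.

Lemma local_gain1E (R : realType) (VAR t : R) : 0 < VAR ->
  ((VAR%:E + 2%:E / (t ^+ 2)%:E)^-1 = (local_gain1 VAR t)%:E)%E.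
Proof.
move=> V0; rewrite /local_gain1 inver sqrf_eq0; case: eqVneq => [->|t0].
  by rewrite expr0n /= mul0r gt0_muley ?lte_fin // addey // invey.
rewrite -EFinM -EFinD inver.
have t2 : 0 < t ^+ 2 by rewrite exprn_even_gt0.
have V2 : 0 < VAR + 2 / t ^+ 2 by rewrite addr_gt0 ?divr_gt0.
have V3 : 0 < VAR * t ^+ 2 + 2 by exact: local_den_gt0.
rewrite gt_eqF //; congr (_%:E); field.
by rewrite t0 !gt_eqF.
Qed.

Lemma local_objectiveE (R : realType) (n : nat) (VAR : R) (psi : 'I_n -> R) :
  0 < VAR ->
  local_objective VAR psi =
  gain_objective n.+1%:R (local_gain VAR) (linear_cost psi).
Proof.
move=> V0; apply/funext => y; rewrite /local_objective /gain_objective.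
by rewrite (eq_bigr _ (fun i _ => local_gain1E (y ord0 i) V0)) sumEFin.
Qed.

Lemma central_den_gt0 (R : realType) (n : nat) (VAR : R) (y : 'rV[R]_n) :
  0 < VAR -> 0 < 2 + \sum_(i < n) y ord0 i ^+ 2 * VAR.
Proof.
move=> V0; rewrite ltr_wpDr // sumr_ge0 // => i _.
by rewrite mulr_ge0 ?sqr_ge0 // ltW.
Qed.

Lemma central_objectiveE (R : realType) (n : nat) (VAR : R) (psi : 'I_n -> R) :
  0 < VAR ->
  central_objective VAR psi =
  gain_objective n.+1%:R (central_gain VAR) (linear_cost psi).
Proof.
move=> V0; apply/funext => y; rewrite /central_objective /gain_objective.
congr (_ + _)%E; rewrite /central_gain.
have := central_den_gt0 y V0.
set D := 2 + _ => D0; set S := \sum_j _.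
have SD0 : (S ^+ 2 / D == 0) = (S ^+ 2 == 0).
  by rewrite mulf_eq0 invr_eq0 (gt_eqF D0) orbF.
rewrite !inver SD0; case: eqVneq => S0.
  by rewrite gt0_muley ?lte_fin ?ltr0n // gt0_mulye ?lte_fin.
by rewrite -!EFinM invf_div mulrAC mulrA.
Qed.

(** * Sign, size and continuity of the gains and of the linear cost *)

Lemma local_gain1_ge0 (R : realType) (VAR t : R) :
  0 < VAR -> 0 <= local_gain1 VAR t.
Proof. by move=> V0; rewrite divr_ge0 ?sqr_ge0 // ltW // local_den_gt0. Qed.

(** Bounds the gain lost when a level [t] is reset to [0]: the loss is quadratic, while the saving
    in cost is linear. *)
Lemma local_gain1_le (R : realType) (VAR t : R) :
  0 < VAR -> local_gain1 VAR t <= t ^+ 2 / 2.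
Proof.
move=> V0; rewrite ler_wpM2l ?sqr_ge0 // lef_pV2 ?posrE ?local_den_gt0 //.
by rewrite lerDr mulr_ge0 ?sqr_ge0 ?ltW.
Qed.

Lemma local_gain_ge0 (R : realType) (n : nat) (VAR : R) (y : 'rV[R]_n) :
  0 < VAR -> 0 <= local_gain VAR y.
Proof. by move=> V0; apply: sumr_ge0 => i _; exact: local_gain1_ge0. Qed.

Lemma central_gain_ge0 (R : realType) (n : nat) (VAR : R) (y : 'rV[R]_n) :
  0 < VAR -> 0 <= central_gain VAR y.
Proof. by move=> V0; rewrite divr_ge0 ?sqr_ge0 // ltW // central_den_gt0. Qed.

Lemma sum_continuous (R : realType) (T : topologicalType) (n : nat)
    (f : 'I_n -> T -> R) :
  (forall i, continuous (f i)) -> continuous (fun y => \sum_(i < n) f i y).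
Proof.
by move=> cf; apply: (continuous_big add_continuous) => i _; exact: cf.
Qed.

Lemma linear_cost_continuous (R : realType) (n : nat) (psi : 'I_n -> R) :
  continuous (linear_cost psi).
Proof.
apply: sum_continuous => i y.
by apply: continuousM; [exact: cst_continuous|exact: coord_continuous].
Qed.

Lemma coord_sqr_continuous (R : realType) (n : nat) (i : 'I_n) :
  continuous (fun y : 'rV[R]_n => y ord0 i ^+ 2).
Proof. by move=> y; apply: continuousM; exact: coord_continuous. Qed.

Lemma local_gain_continuous (R : realType) (n : nat) (VAR : R) :
  0 < VAR -> continuous (@local_gain R n VAR).
Proof.
move=> V0; apply: sum_continuous => i y.
have c2 := @coord_sqr_continuous R n i.
apply: (@continuousM _ _ (fun x : 'rV[R]_n => x ord0 i ^+ 2)).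
  exact: c2.
apply: continuousV; first by rewrite gt_eqF // local_den_gt0.
apply: continuousD; last exact: cst_continuous.
by apply: continuousM; [exact: cst_continuous|exact: c2].
Qed.

Lemma central_gain_continuous (R : realType) (n : nat) (VAR : R) :
  0 < VAR -> continuous (@central_gain R n VAR).
Proof.
move=> V0 y.
have cS : continuous (fun x : 'rV[R]_n => \sum_(i < n) x ord0 i).
  by apply: sum_continuous => i; exact: coord_continuous.
apply: (@continuousM _ _ (fun x : 'rV[R]_n => (\sum_(j < n) x ord0 j) ^+ 2)).
  by apply: continuousM; exact: cS.
apply: continuousV; first by rewrite gt_eqF // central_den_gt0.
apply: continuousD; first exact: cst_continuous.
apply: sum_continuous => i x.
apply: (@continuousM _ _ (fun z : 'rV[R]_n => z ord0 i ^+ 2)).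
  exact: coord_sqr_continuous.
exact: cst_continuous.
Qed.

Lemma linear_cost_ge0 (R : realType) (n : nat) (psi : 'I_n -> R)
    (y : 'rV[R]_n) :
  (forall i, 0 <= psi i) -> (forall i, 0 <= y ord0 i) -> 0 <= linear_cost psi y.
Proof. by move=> psi0 y0; apply: sumr_ge0 => i _; rewrite mulr_ge0. Qed.

Lemma linear_cost_coercive (R : realType) (n : nat) (psi : 'I_n -> R) (p : R)
    (y : 'rV[R]_n) (i : 'I_n) :
  (forall i, 0 <= psi i) -> p <= psi i -> (forall i, 0 <= y ord0 i) ->
  p * y ord0 i <= linear_cost psi y.
Proof.
move=> psi0 ppsi y0; rewrite /linear_cost (bigD1 i) //= ler_wpDr ?ler_wpM2r //.
by apply: sumr_ge0 => j _; rewrite mulr_ge0.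
Qed.

Lemma linear_costE (R : realType) (n : nat) (psi : 'I_n -> R) (psi1 : R)
    (u : 'I_n) (y : 'rV[R]_n) :
  (forall i, i != u -> psi i = psi1) ->
  linear_cost psi y =
  psi1 * \sum_(i < n) y ord0 i + (psi u - psi1) * y ord0 u.
Proof.
move=> psiE; rewrite /linear_cost (bigD1 u) //= [in RHS](bigD1 u) //=.
under eq_bigr => i iu do rewrite psiE //.
by rewrite -mulr_sumr; ring.
Qed.

(** Since [0] to a nonzero power is [0], the value at [n = 0] is replaced by [1] to keep the
    sequence positive everywhere; the asymptotic class does not see it. *)
Lemma bigTheta_powR (R : realType) (k p : R) : 0 < k ->
  (fun n : nat => if n is 0 then 1 else k * n%:R `^ p) \is
    'Theta_\oo (fun n : nat => (n%:R : R) `^ p).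
Proof.
move=> k0; apply/asboolP; exists (k, k) => /=; first by rewrite k0.
apply: filterS (nbhs_infty_gt 0) => -[|m] // _.
by rewrite normrM (gtr0_norm k0).
Qed.

(** * Local setting: the expensive user gets level zero *)

(** Swapping the levels of [u] and [j] preserves the gain and the total, so optimality only compares
    the extra cost [psi u - psi1] applied to each of the two levels. *)
Lemma local_level_le (R : realType) (n : nat) (VAR c psi1 : R) (psi : 'I_n -> R)
    (u j : 'I_n) (y : 'rV[R]_n) :
  (forall i, i != u -> psi i = psi1) -> psi1 < psi u ->
  (forall i, 0 <= y ord0 i) -> 0 < local_gain VAR y ->
  (forall z : 'rV[R]_n, (forall i, 0 <= z ord0 i) -> 0 < local_gain VAR z ->
     c / local_gain VAR y + linear_cost psi y <=
     c / local_gain VAR z + linear_cost psi z) ->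
  y ord0 u <= y ord0 j.
Proof.
move=> psiE psiu y0 Hy ymin; have [->//|ju] := eqVneq j u.
pose z : 'rV[R]_n := \row_i y ord0 (tperm u j i).
have zE i : z ord0 i = y ord0 (tperm u j i) by rewrite mxE.
have Hz : local_gain VAR z = local_gain VAR y.
  rewrite /local_gain [RHS](reindex_inj (@perm_inj _ (tperm u j))).
  by apply: eq_bigr => i _; rewrite zE.
have Sz : \sum_(i < n) z ord0 i = \sum_(i < n) y ord0 i.
  rewrite [RHS](reindex_inj (@perm_inj _ (tperm u j))).
  by apply: eq_bigr => i _; rewrite zE.
have := ymin z; rewrite Hz => /(_ _ Hy) zP.
have {}zP := zP (fun i => eq_ind_r (fun t => 0 <= t) (y0 _) (zE i)).
move: zP; rewrite lerD2l !(linear_costE _ psiE) Sz lerD2l zE tpermL.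
by rewrite ler_pM2l // subr_gt0.
Qed.

(** Here [C * k] is a budget for the optimal value, with [k] of order [sqrt n]. Resetting a level
    [e > 0] of user [u] saves at least [psi1 * e] and costs at most [4 * C ^+ 2 * e ^+ 2], while the
    budget forces [psi1 * k * e <= C]; together these contradict the size of [k]. *)
Lemma local_level_eq0 (R : realType) (n k : nat) (VAR psi1 C : R)
    (psi : 'I_n -> R) (u : 'I_n) (y : 'rV[R]_n) :
  0 < VAR -> 0 < psi1 -> 1 <= C ->
  (k ^ 2 <= n)%N -> (n.+1 <= 4 * k ^ 2)%N -> 4 * C ^+ 3 < psi1 ^+ 2 * k%:R ->
  (forall i, i != u -> psi i = psi1) -> psi1 < psi u ->
  (forall i, 0 <= y ord0 i) -> 0 < local_gain VAR y ->
  n.+1%:R / local_gain VAR y + linear_cost psi y <= C * k%:R ->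
  (forall z : 'rV[R]_n, (forall i, 0 <= z ord0 i) -> 0 < local_gain VAR z ->
     n.+1%:R / local_gain VAR y + linear_cost psi y <=
     n.+1%:R / local_gain VAR z + linear_cost psi z) ->
  y ord0 u = 0.
Proof.
move=> V0 p0 C1 kn nk Ck psiE psiu y0 Hy ub ymin.
apply/eqP; apply: contraT => yu_neq0.
have yu_le j : y ord0 u <= y ord0 j.
  exact: (local_level_le _ psiE psiu y0 Hy ymin).
have := y0 u; rewrite le_eqVlt eq_sym (negPf yu_neq0) /= => e0.
set e := y ord0 u in e0 yu_le *.
set S := \sum_(i < n) y ord0 i.
set G := local_gain VAR y in Hy ub ymin.
pose g := local_gain1 VAR e.
have g0 : 0 <= g by exact: local_gain1_ge0.
have g_le : g <= e ^+ 2 / 2 by exact: local_gain1_le.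
have S_ge : n%:R * e <= S.
  have -> : n%:R * e = \sum_(i < n) e by rewrite sumr_const card_ord mulr_natl.
  by apply: ler_sum => i _; exact: yu_le.
have LE : linear_cost psi y = psi1 * S + (psi u - psi1) * e.
  exact: linear_costE.
have k2n : k%:R ^+ 2 <= n%:R :> R by rewrite -natrX ler_nat.
have n4k : n.+1%:R <= 4 * k%:R ^+ 2 :> R by rewrite -natrX -natrM ler_nat.
have nS : n.+1%:R = n%:R + 1 :> R by rewrite -natr1.
set K : R := k%:R in Ck ub k2n n4k.
set N : R := n.+1%:R in ub ymin n4k nS.
have K1 : 1 <= K.
  rewrite ler1n lt0n; apply/eqP => k0.
  move: Ck; rewrite /K k0 mulr0; apply/negP.
  by rewrite -leNgt mulr_ge0 ?exprn_ge0; lra.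
have K0 : 0 < K by lra.
have de0 : 0 <= (psi u - psi1) * e by rewrite mulr_ge0 ?subr_ge0 ?ltW.
(* Since [e] is the smallest of the [n >= K ^+ 2] levels, the linear cost is at least
   [psi1 * K ^+ 2 * e], and it must fit in the budget [C * K]. *)
have x_le : psi1 * K * e <= C.
  have NG0 : 0 <= N / G by rewrite divr_ge0 // ltW.
  have h1 : psi1 * (K ^+ 2 * e) <= psi1 * S.
    by rewrite ler_wpM2l ?(ltW p0) // (le_trans _ S_ge) // ler_wpM2r // ltW.
  have h2 : psi1 * K * e * K <= C * K.
    have -> : psi1 * K * e * K = psi1 * (K ^+ 2 * e) by ring.
    lra.
  by rewrite -(ler_pM2r K0).
have x0 : 0 < psi1 * K * e by rewrite !mulr_gt0.
(* The first term must fit in the budget too; its numerator is at least [K ^+ 2], so the gain is at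
   least [K / C]. *)
have CG : K <= C * G.
  have NG : N / G <= C * K.
    have S0 : 0 <= psi1 * S.
      rewrite mulr_ge0 ?ltW // (lt_le_trans _ S_ge) // mulr_gt0 //.
      by rewrite (lt_le_trans _ k2n) // exprn_gt0.
    lra.
  move: NG; rewrite ler_pdivrMr // => NG.
  rewrite -(ler_pM2l K0); have -> : K * (C * G) = C * K * G by ring.
  by apply: le_trans NG; rewrite -expr2; lra.
have C0 : 0 < C by lra.
(* By [x_le], [g] is of order [1 / K ^+ 2]; the lower bound on [K] makes it so small that the gain
   without user [u] is still at least [K / (2 C)]. *)
have gC : C * g <= K / 4.
  have x2 : (psi1 * K * e) ^+ 2 <= C ^+ 2.
    by rewrite lerXn2r ?nnegrE ?(ltW x0) ?(ltW C0).
  have P0 : 0 < psi1 ^+ 2 * K by rewrite mulr_gt0 ?exprn_gt0.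
  have h : (psi1 ^+ 2 * K) * (C * g) <= (psi1 ^+ 2 * K) * (K / 4).
    have h1 : psi1 ^+ 2 * K * (C * g) <= psi1 ^+ 2 * K * (C * (e ^+ 2 / 2)).
      by rewrite ler_pM2l // ler_pM2l.
    have h2 : K * (psi1 ^+ 2 * K * (C * (e ^+ 2 / 2))) <= C ^+ 3 / 2.
      have -> : K * (psi1 ^+ 2 * K * (C * (e ^+ 2 / 2))) =
        C * ((psi1 * K * e) ^+ 2) / 2 by field.
      have -> : C ^+ 3 / 2 = C * C ^+ 2 / 2 by field.
      by rewrite ler_pM2r // ler_pM2l.
    have h3 : psi1 ^+ 2 * K * (C * (e ^+ 2 / 2)) <= C ^+ 3 / 2.
      apply: le_trans h2; rewrite ler_peMl //.
      by rewrite !mulr_ge0 ?exprn_ge0 ?sqr_ge0 ?ltW.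
    have h4 : psi1 ^+ 2 * K * (1 / 4) <= psi1 ^+ 2 * K * (K / 4).
      by rewrite ler_pM2l // ler_pM2r.
    lra.
  by rewrite -(ler_pM2l P0).
have CGg : K / 2 <= C * (G - g) by rewrite mulrBr; lra.
have Gg0 : 0 < G - g.
  by rewrite -(pmulr_rgt0 _ C0) (lt_le_trans _ CGg) // divr_gt0.
pose z : 'rV[R]_n := \row_i (if i == u then 0 else y ord0 i).
have z0 i : 0 <= z ord0 i by rewrite mxE; case: eqP.
have Hz : local_gain VAR z = G - g.
  rewrite /G /local_gain (bigD1 u) //= [in RHS](bigD1 u) //= mxE eqxx.
  rewrite -/e -/g /local_gain1 expr0n /= mul0r add0r addrAC subrr add0r.
  by apply: eq_bigr => i iu; rewrite mxE (negPf iu).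
have Lz : linear_cost psi z = linear_cost psi y - psi u * e.
  rewrite /linear_cost (bigD1 u) //= [in RHS](bigD1 u) //= mxE eqxx.
  rewrite mulr0 add0r -/e addrAC subrr add0r.
  by apply: eq_bigr => i iu; rewrite mxE (negPf iu).
have := ymin z z0; rewrite Hz Lz => /(_ Gg0) opt.
have NE : N / (G - g) - N / G = N * g / (G * (G - g)).
  by field; rewrite !gt_eqF.
have opt2 : psi1 * e <= N * g / (G * (G - g)).
  have : psi1 * e <= psi u * e by rewrite ler_pM2r // ltW.
  lra.
move: opt2; rewrite ler_pdivlMr ?mulr_gt0 // => opt2.
have Ng : N * g <= 2 * K ^+ 2 * e ^+ 2.
  have -> : 2 * K ^+ 2 * e ^+ 2 = 4 * K ^+ 2 * (e ^+ 2 / 2) by field.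
  by rewrite ler_pM // ler0n.
have GG : K ^+ 2 / 2 <= C ^+ 2 * (G * (G - g)).
  have -> : K ^+ 2 / 2 = K * (K / 2) by ring.
  have -> : C ^+ 2 * (G * (G - g)) = (C * G) * (C * (G - g)) by ring.
  by rewrite ler_pM // ?divr_ge0 // ltW.
have fin : psi1 * e * (K ^+ 2 / 2) <= C ^+ 2 * (2 * K ^+ 2 * e ^+ 2).
  have h1 : psi1 * e * (K ^+ 2 / 2) <= psi1 * e * (C ^+ 2 * (G * (G - g))).
    by rewrite ler_pM2l // mulr_gt0.
  have h2 : C ^+ 2 * (psi1 * e * (G * (G - g))) <=
      C ^+ 2 * (2 * K ^+ 2 * e ^+ 2).
    by rewrite ler_pM2l ?exprn_gt0 // (le_trans opt2).
  by apply: (le_trans h1); rewrite mulrCA.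
have fin2 : psi1 <= 4 * C ^+ 2 * e.
  have P0 : 0 < e * (K ^+ 2 / 2) by rewrite !mulr_gt0 ?divr_gt0 ?exprn_gt0.
  rewrite -(ler_pM2r P0); move: fin.
  have -> : psi1 * (e * (K ^+ 2 / 2)) = psi1 * e * (K ^+ 2 / 2) by ring.
  suff -> : 4 * C ^+ 2 * e * (e * (K ^+ 2 / 2)) =
    C ^+ 2 * (2 * K ^+ 2 * e ^+ 2) by [].
  by field.
(* Multiplying [fin2] by [psi1 * K] brings back the product [psi1 * K * e], which [x_le] bounds by
   [C]. *)
have fin3 : psi1 ^+ 2 * K <= 4 * C ^+ 3.
  have h1 : psi1 * K * psi1 <= psi1 * K * (4 * C ^+ 2 * e).
    by rewrite ler_pM2l // mulr_gt0.
  have h2 : 4 * C ^+ 2 * (psi1 * K * e) <= 4 * C ^+ 2 * C.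
    by rewrite ler_pM2l // mulr_gt0 // exprn_gt0.
  have -> : psi1 ^+ 2 * K = psi1 * K * psi1 by ring.
  have -> : 4 * C ^+ 3 = 4 * C ^+ 2 * C by ring.
  apply: (le_trans h1); apply: le_trans h2.
  by rewrite le_eqVlt; apply/orP; left; apply/eqP; ring.
by move: fin3; rewrite leNgt Ck.
Qed.

(** * Central setting: the expensive user gets a positive level *)

Lemma central_level_neq0 (R : realType) (n : nat) (VAR psi1 : R)
    (psi : 'I_n -> R) (u : 'I_n) (y : 'rV[R]_n) :
  0 < VAR -> (forall i, i != u -> psi i = psi1) ->
  (psi u - psi1) * \sum_(i < n) y ord0 i <= VAR ->
  (forall i, 0 <= y ord0 i) -> 0 < central_gain VAR y ->
  (forall z : 'rV[R]_n, (forall i, 0 <= z ord0 i) -> 0 < central_gain VAR z ->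
     n.+1%:R / central_gain VAR y + linear_cost psi y <=
     n.+1%:R / central_gain VAR z + linear_cost psi z) ->
  y ord0 u <> 0.
Proof.
move=> V0 psiE dS y0 Hy ymin yu0.
set S := \sum_(i < n) y ord0 i in dS.
have S0 : 0 < S.
  rewrite lt_neqAle sumr_ge0 // andbT eq_sym; apply/eqP => S0.
  by move: Hy; rewrite /central_gain -/S S0 expr0n /= mul0r ltxx.
have [j Sj] : exists j, S <= n%:R * y ord0 j.
  exists [arg max_(i > u) y ord0 i]%O; case: arg_maxP => // j _ ymax.
  have -> : n%:R * y ord0 j = \sum_(i < n) y ord0 j.
    by rewrite sumr_const card_ord mulr_natl.
  by apply: ler_sum => i _; exact: ymax.
set t := y ord0 j in Sj.
have nR : (0 : R) < n%:R by rewrite ltr0n (leq_ltn_trans _ (ltn_ord u)).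
have t0 : 0 < t by rewrite -(pmulr_rgt0 _ nR) (lt_le_trans S0).
have ju : j != u by apply/eqP => ju; move: t0; rewrite /t ju yu0 ltxx.
(* The largest level [t] is shared equally with user [u]: the total is unchanged, the sum of squares
   drops by [t ^+ 2 / 2], and the linear cost grows by [(psi u - psi1) * (t / 2)]. *)
pose z : 'rV[R]_n :=
  \row_i (if (i == u) || (i == j) then t / 2 else y ord0 i).
have zu : z ord0 u = t / 2 by rewrite mxE eqxx.
have zj : z ord0 j = t / 2 by rewrite mxE eqxx orbT.
have zE i : (i != u) && (i != j) -> z ord0 i = y ord0 i.
  by rewrite mxE -negb_or => /negPf ->.
have z0 i : 0 <= z ord0 i by rewrite mxE; case: ifP; rewrite // divr_ge0 ?ltW.
have Sz : \sum_(i < n) z ord0 i = S.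
  rewrite /S (bigD1 u) //= [in RHS](bigD1 u) //= (bigD1 j) //=.
  rewrite [in RHS](bigD1 j) //= zu zj yu0 -/t (eq_bigr _ zE) //.
  by field.
have Qz : \sum_(i < n) z ord0 i ^+ 2 * VAR =
    \sum_(i < n) y ord0 i ^+ 2 * VAR - t ^+ 2 / 2 * VAR.
  rewrite (bigD1 u) //= [in RHS](bigD1 u) //= (bigD1 j) //=.
  rewrite [in RHS](bigD1 j) //= zu zj yu0 -/t.
  rewrite (eq_bigr (fun i => y ord0 i ^+ 2 * VAR)) => [|i iuj].
    by field.
  by rewrite zE.
have Hz : 0 < central_gain VAR z.
  by rewrite divr_gt0 ?central_den_gt0 // Sz exprn_gt0.
have := ymin z z0 Hz; rewrite !(linear_costE _ psiE) Sz zu yu0 -/S mulr0 addr0.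
rewrite /central_gain Sz Qz -/S.
have := central_den_gt0 z V0; rewrite Qz.
have := central_den_gt0 y V0.
set Q := \sum_(i < n) y ord0 i ^+ 2 * VAR => D1 D2.
rewrite !invf_div !mulrA => opt.
have h : n.+1%:R * (t ^+ 2 / 2 * VAR) / S ^+ 2 <= (psi u - psi1) * (t / 2).
  have : n.+1%:R * (t ^+ 2 / 2 * VAR) / S ^+ 2 = n.+1%:R * (2 + Q) / S ^+ 2 -
      n.+1%:R * (2 + (Q - t ^+ 2 / 2 * VAR)) / S ^+ 2.
    by field; rewrite gt_eqF.
  lra.
move: h; rewrite ler_pdivrMr ?exprn_gt0 // => h.
have h2 : n.+1%:R * t * VAR <= (psi u - psi1) * S * S.
  have t2 : 0 < t / 2 by rewrite divr_gt0.
  rewrite -(ler_pM2r t2).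
  have -> : n.+1%:R * t * VAR * (t / 2) = n.+1%:R * (t ^+ 2 / 2 * VAR) by field.
  by apply: (le_trans h); rewrite le_eqVlt; apply/orP; left; apply/eqP; ring.
have h3 : (psi u - psi1) * S * S <= VAR * (n%:R * t).
  by apply: (le_trans (ler_wpM2r (ltW S0) dS)); rewrite ler_pM2l.
have tV : 0 < t * VAR by rewrite mulr_gt0.
(* The contradiction comes from the factor [n + 1] of the objective against [S <= n * t]: the
   surplus [t * VAR] is positive. *)
have h4 : n.+1%:R * t * VAR = VAR * (n%:R * t) + t * VAR.
  by rewrite -natr1; ring.
lra.
Qed.

(** * Test points bounding the optimal values, and existence of optimal solutions *)

Lemma central_objective_upper (R : realType) (n : nat) (VAR psi1 s : R)
    (psi : 'I_n -> R) (u : 'I_n) :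
  0 < VAR -> 1 <= s -> s ^+ 3 = n%:R ->
  (forall i, i != u -> psi i = psi1) -> psi u - psi1 <= VAR ->
  exists y : 'rV[R]_n, [/\ forall i, 0 <= y ord0 i, 0 < central_gain VAR y &
    n.+1%:R / central_gain VAR y + linear_cost psi y <=
    (4 + 3 * VAR + psi1) * s].
Proof.
move=> V0 s1 s3 psiE dV; have s0 : 0 < s by lra.
have nE : n.+1%:R = s ^+ 3 + 1 :> R by rewrite s3 natr1.
(* With [s] the cube root of [n], the common level [n^(-2/3)] gives total [s] and sum of squares
   [1 / s]. The three [VAR] in the bound absorb the constant [VAR], the term [VAR / s ^+ 3] and the
   extra cost of user [u]. *)
pose y : 'rV[R]_n := const_mx (s ^- 2).
have yE i : y ord0 i = s ^- 2 by rewrite mxE.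
have Sy : \sum_(i < n) y ord0 i = s.
  rewrite (eq_bigr _ (fun i _ => yE i)) sumr_const card_ord -mulr_natl -s3.
  by field; rewrite gt_eqF.
have Qy : \sum_(i < n) y ord0 i ^+ 2 * VAR = VAR / s.
  rewrite (eq_bigr (fun=> s ^- 2 ^+ 2 * VAR)) => [|i _]; last by rewrite yE.
  by rewrite sumr_const card_ord -mulr_natl -s3; field; rewrite gt_eqF.
exists y; split=> [i||].
- by rewrite yE invr_ge0 exprn_ge0 ?ltW.
- by rewrite divr_gt0 ?central_den_gt0 // Sy exprn_gt0.
rewrite (linear_costE _ psiE) Sy yE /central_gain Sy Qy invf_div nE.
have is1 : s^-1 <= 1 by rewrite invf_le1.
have is0 : 0 < s^-1 by rewrite invr_gt0.
have h1 : (s ^+ 3 + 1) * ((2 + VAR / s) / s ^+ 2) =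
    2 * s + VAR + 2 * s^-1 ^+ 2 + VAR * s^-1 ^+ 3.
  by field; rewrite gt_eqF.
have h2 : s^-1 ^+ 2 <= 1 by rewrite exprn_ile1 // ltW.
have h3 : s^-1 ^+ 3 <= 1 by rewrite exprn_ile1 // ltW.
have h4 : VAR * s^-1 ^+ 3 <= VAR by rewrite ler_piMr // ltW.
have h5 : (psi u - psi1) * s ^- 2 <= VAR.
  rewrite -exprVn; apply: (le_trans (ler_wpM2r _ dV)); first by rewrite sqr_ge0.
  by rewrite ler_piMr // ltW.
have h6 : VAR <= VAR * s by rewrite ler_peMr // ltW.
rewrite h1; lra.
Qed.

Lemma local_objective_upper (R : realType) (n k : nat) (VAR psi1 : R)
    (psi : 'I_n -> R) (u : 'I_n) :
  0 < VAR -> (0 < k)%N -> (k <= u)%N -> (n.+1 <= 4 * k ^ 2)%N ->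
  (forall i, i != u -> psi i = psi1) ->
  exists y : 'rV[R]_n, [/\ forall i, 0 <= y ord0 i, 0 < local_gain VAR y &
    n.+1%:R / local_gain VAR y + linear_cost psi y <=
    (4 * (VAR + 2) + psi1) * k%:R].
Proof.
move=> V0 k0 ku nk psiE.
(* Only the first [k] users get level [1]; [k <= u] keeps user [u] out, so no extra cost is paid. *)
pose y : 'rV[R]_n := \row_i (i < k)%:R.
have yE i : y ord0 i = (i < k)%:R by rewrite mxE.
have kn : (k <= n)%N by rewrite (leq_trans ku) // ltnW.
have sumk (F : R) : \sum_(i < n) (if (i < k)%N then F else 0) = k%:R * F.
  rewrite -big_mkcond /= -(big_ord_widen n (fun=> F) kn).
  by rewrite sumr_const card_ord mulr_natl.
have Gy : local_gain VAR y = k%:R / (VAR + 2).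
  rewrite -sumk; apply: eq_bigr => i _.
  rewrite yE /local_gain1; case: ifP => _; last by rewrite expr0n /= mul0r.
  by rewrite expr1n mulr1 mul1r.
have Sy : \sum_(i < n) y ord0 i = k%:R.
  rewrite -[RHS]mulr1 -sumk; apply: eq_bigr => i _.
  by rewrite yE; case: ifP.
have kR : (0 : R) < k%:R by rewrite ltr0n.
have V2 : 0 < VAR + 2 by lra.
exists y; split=> [i||]; first by rewrite yE.
- by rewrite Gy divr_gt0.
rewrite (linear_costE _ psiE) Sy yE ltnNge ku /= mulr0 addr0 Gy mulrDl lerD2r.
rewrite invf_div mulrA ler_pdivrMr //.
have : n.+1%:R <= 4 * k%:R ^+ 2 :> R by rewrite -natrX -natrM ler_nat.
rewrite -(ler_pM2r V2) => /le_trans; apply.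
by rewrite le_eqVlt; apply/orP; left; apply/eqP; ring.
Qed.

Lemma gain_objective_linear_exists (R : realType) (n : nat) (c p : R)
    (psi : 'I_n -> R) (H : 'rV[R]_n -> R) (z : 'rV[R]_n) :
  0 < c -> 0 < p -> (forall i, p <= psi i) ->
  (forall x, 0 <= H x) -> continuous H ->
  (forall i, 0 <= z ord0 i) -> 0 < H z ->
  optimal_solution (gain_objective c H (linear_cost psi)) !=set0.
Proof.
move=> c0 p0 ppsi H0 cH z0 Hz.
have psi0 i : 0 <= psi i by rewrite (le_trans (ltW p0)).
apply: (gain_objective_optimal_exists c0 p0 H0 cH _ _ _ z0 Hz).
- exact: linear_cost_continuous.
- by move=> y i y0; exact: linear_cost_coercive.
- by move=> y y0; exact: linear_cost_ge0.
Qed.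

Lemma exists_sqrtn (n : nat) : exists k, (k ^ 2 <= n < k.+1 ^ 2)%N.
Proof.
elim: n => [|n [k /andP[kn nk]]]; first by exists 0%N.
have [nk1|nk1] := ltnP n.+1 (k.+1 ^ 2); first by exists k; rewrite nk1 leqW.
by exists k.+1; rewrite nk1 (leq_ltn_trans nk) // ltn_exp2r.
Qed.

(** * Choice of the constants and conclusion *)

Theorem proposition6 (R : realType) (VAR psi1 : R)
    (VAR_gt0 : 0 < VAR) (psi1_gt0 : 0 < psi1) :
  exists (N : nat) (a b : nat -> R),
    [/\ forall n, 0 < a n,
        forall n, 0 < b n,
        a \is 'Theta_\oo (fun n : nat => (n%:R : R) `^ (- (2 / 3))),
        b \is 'Theta_\oo (fun n : nat => (n%:R : R) `^ (- (1 / 3))) &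
        forall (n : nat) (u : 'I_n) (psi : 'I_n -> R),
          (N <= n)%N ->
          u.+1 = n ->
          (forall i : 'I_n, i != u -> psi i = psi1) ->
          psi1 + a n <= psi u <= psi1 + b n ->
          optimal_level (local_objective VAR psi) u (fun t => t = 0) /\
          optimal_level (central_objective VAR psi) u (fun t => t <> 0)].
Proof.
(* [C] and [D] are the coefficients in the upper bounds given by the local and the central test
   points. *)
pose C := 4 * (VAR + 2) + psi1.
pose D := 4 + 3 * VAR + psi1.
have D0 : 0 < D by rewrite /D; lra.
have C1 : 1 <= C by rewrite /C; lra.
(* Chosen so that an extra cost [kb / s] times a total level [D * s / psi1] is exactly [VAR], the
   threshold of the averaging argument. *)
pose kb := VAR * psi1 / D.
have kb0 : 0 < kb by rewrite divr_gt0 ?mulr_gt0.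
have kbV : kb <= VAR by rewrite ler_pdivrMr // ler_pM2l // /D; lra.
(* The Archimedean bound makes [4 * C ^+ 3 < psi1 ^+ 2 * k] for [k >= K0], and the shift by two
   ensures [k >= 2]. *)
pose K0 := (Num.bound (4 * C ^+ 3 / psi1 ^+ 2)).+2.
pose a (n : nat) : R := if n is 0 then 1 else 1 * n%:R `^ (- (2 / 3)).
pose b (n : nat) : R := if n is 0 then 1 else kb * n%:R `^ (- (1 / 3)).
exists (K0.+1 ^ 2)%N, a, b; split.
- by case=> [|n] //=; rewrite mul1r powR_gt0.
- by case=> [|n] //=; rewrite mulr_gt0 ?powR_gt0.
- exact: bigTheta_powR.
- exact: bigTheta_powR.
move=> n u psi Nn un psiE /andP[au ub].
have n0 : (0 < n)%N by rewrite -un.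
have psiu : psi1 < psi u.
  apply: lt_le_trans au; rewrite ltrDl.
  by case: (n) n0 => // m _; rewrite /a mul1r powR_gt0.
pose s : R := n%:R `^ (1 / 3).
have s3 : s ^+ 3 = n%:R.
  by rewrite -powR_mulrn ?powR_ge0 // -powRrM divfK ?powRr1.
have s1 : 1 <= s.
  by rewrite -(@powRr0 R n%:R) ler_powR ?ler1n.
have s0 : 0 < s by lra.
have bE : b n = kb / s.
  by rewrite /b /s -powRN; case: (n) n0.
have du : psi u - psi1 <= kb / s by rewrite -bE; lra.
have duV : psi u - psi1 <= VAR.
  apply: (le_trans du); apply: (le_trans _ kbV).
  by rewrite ler_piMr ?(ltW kb0) // invf_le1.
have psi_ge i : psi1 <= psi i.
  by have [->|/psiE ->//] := eqVneq i u; rewrite ltW.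
have nR : 0 < n.+1%:R :> R by rewrite ltr0n.
split.
- rewrite local_objectiveE //.
  have [k /andP[kn nk]] := exists_sqrtn n.
  have Kk : (K0 <= k)%N.
    by rewrite ltnW // -ltnS -(@ltn_exp2r _ _ 2) // (leq_ltn_trans Nn).
  have k2 : (1 < k)%N by rewrite (leq_trans _ Kk).
  have nk4 : (n.+1 <= 4 * k ^ 2)%N.
    rewrite (leq_trans nk) // -[4%N]/(2 ^ 2)%N -expnMn leq_exp2r //.
    by rewrite mul2n -addnn -addn1 leq_add2l ltnW.
  (* User [u] has index [n - 1], and [k >= 2] gives [k < k ^ 2 <= n]. *)
  have ku : (k <= u)%N.
    rewrite -ltnS un (leq_trans _ kn) // -mulnn.
    by rewrite -[X in (X < _)%N]muln1 ltn_mul2l k2 ltnW.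
  have Ck : 4 * C ^+ 3 < psi1 ^+ 2 * k%:R.
    rewrite [ltRHS]mulrC -ltr_pdivrMr ?exprn_gt0 //.
    have q0 : 0 <= 4 * C ^+ 3 / psi1 ^+ 2.
      by rewrite divr_ge0 ?sqr_ge0 // mulr_ge0 ?exprn_ge0 //; lra.
    rewrite (lt_le_trans (archi_boundP q0)) // ler_nat (leq_trans _ Kk) //.
    exact: leqW.
  have [z [z0 Hz zub]] := local_objective_upper VAR_gt0 (ltnW k2) ku nk4 psiE.
  have H0 (x : 'rV[R]_n) : 0 <= local_gain VAR x by exact: local_gain_ge0.
  split.
    apply: (gain_objective_linear_exists nR psi1_gt0 psi_ge H0 _ z0 Hz).
    exact: local_gain_continuous.
  move=> y yopt; have [y0 _] := yopt.
  have [Hy yz] := gain_objective_optimal nR H0 yopt z0 Hz.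
  apply: (local_level_eq0 VAR_gt0 psi1_gt0 C1 kn nk4 Ck psiE psiu y0 Hy).
    exact: le_trans zub.
  by move=> x x0 Hx; case: (gain_objective_optimal nR H0 yopt x0 Hx).
- rewrite central_objectiveE //.
  have [z [z0 Hz zub]] := central_objective_upper VAR_gt0 s1 s3 psiE duV.
  have H0 (x : 'rV[R]_n) : 0 <= central_gain VAR x by exact: central_gain_ge0.
  split.
    apply: (gain_objective_linear_exists nR psi1_gt0 psi_ge H0 _ z0 Hz).
    exact: central_gain_continuous.
  move=> y yopt; have [y0 _] := yopt.
  have [Hy yz] := gain_objective_optimal nR H0 yopt z0 Hz.
  apply: (central_level_neq0 VAR_gt0 psiE _ y0 Hy); last first.
    by move=> x x0 Hx; case: (gain_objective_optimal nR H0 yopt x0 Hx).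
  (* The first term and the extra cost are nonnegative, so the bound on the optimal value is also
     one on the total level. *)
  have Sle : psi1 * \sum_(i < n) y ord0 i <= D * s.
    apply: le_trans (le_trans yz zub); rewrite (linear_costE _ psiE).
    have : 0 <= n.+1%:R / central_gain VAR y by rewrite divr_ge0 // ltW.
    have : 0 <= (psi u - psi1) * y ord0 u by rewrite mulr_ge0 // subr_ge0 ltW.
    lra.
  have S0 : 0 <= \sum_(i < n) y ord0 i by apply: sumr_ge0.
  apply: (le_trans (ler_wpM2r S0 du)).
  rewrite -(ler_pM2l psi1_gt0).
  have Ds : 0 < VAR * psi1 / (D * s) by rewrite !(mulr_gt0, invr_gt0).
  have -> : psi1 * (kb / s * \sum_(i < n) y ord0 i) =
      VAR * psi1 / (D * s) * (psi1 * \sum_(i < n) y ord0 i).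
    by rewrite /kb; field; rewrite !gt_eqF.
  have -> : psi1 * VAR = VAR * psi1 / (D * s) * (D * s).
    by field; rewrite !gt_eqF.
  by rewrite ler_pM2l.
Qed.
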